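(* Let $A\in\mathbb{R}^{m\times n}$, $b\in\mathbb{R}^m$ and $0<q\le 1$. Then there exists a constant $p^*(A,b,q)>0$ such that, whenever $0<p<p^*(A,b,q)$, every solution (global minimizer) of $$\min_{x\in\mathbb{R}^n}\|x\|_{h_{p,q}}\quad\text{s.t. } Ax=b$$ is a solution (global minimizer) of $$\min_{x\in\mathbb{R}^n}\|x\|_{0}\quad\text{s.t. } Ax=b .$$
   Context: For $p>0$ and $0<q\le 1$ let $h_{p,q}(t)=\log\left(1+|t|^q/p\right)$ for $t\in\mathbb{R}$, and for $x\in\mathbb{R}^n$ let $\|x\|_{h_{p,q}}=\sum_{i=1}^n h_{p,q}(x_i)$. $\|x\|_0$ denotes the number of non-zero entries of $x$. *)

(* Defs.v *)
From mathcomp Require Export all_boot all_order all_algebra.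
From mathcomp Require Export classical_sets reals exp.

Set Implicit Arguments.
Unset Strict Implicit.
Unset Printing Implicit Defensive.

Import Order.TTheory GRing.Theory Num.Theory.
Local Open Scope classical_set_scope.
Local Open Scope ring_scope.

(* For t = 0 and q > 0, powR gives 0 `^ q = 0, so h_pq p q 0 = 0. *)
Definition h_pq (R : realType) (p q t : R) : R := ln (1 + `|t| `^ q / p).

Definition norm_h_pq (R : realType) (n : nat) (p q : R) (x : 'cV[R]_n) : R :=
  \sum_(i < n) h_pq p q (x i ord0).

Definition norm0 (R : realType) (n : nat) (x : 'cV[R]_n) : nat :=
  #|[set i : 'I_n | x i ord0 != 0]%SET|.

Definition feasible (R : realType) (m n : nat) (A : 'M[R]_(m, n))
    (b : 'cV[R]_m) : set 'cV[R]_n :=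
  [set x | A *m x = b].

(* The order on the values is kept abstract because norm_h_pq is real-valued
   while norm0 is nat-valued. *)
Definition global_minimizer (T : Type) (d : Order.disp_t) (V : porderType d)
    (f : T -> V) (D : set T) (x : T) : Prop :=
  D x /\ forall y, D y -> (f x <= f y)%O.

(* Main.v *)
(** Fix [p]. If [x] minimizes the [h_pq]-norm and [y] is another feasible point
    whose support lies in that of [x], then for small [e] the feasible points
    [x + e (y - x)] and [x - e (y - x)] have the signs of [x], and strict
    concavity of [h_pq] on the half-lines makes one of them beat [x]. So a
    minimizer is the only feasible point supported in its support; over all
    values of [p], there is at most one minimizer per support, hence finitely
    many of them. As [p] tends to [0], [h_pq p q a = - ln p + O(1)] for each
    fixed [a != 0], so any feasible point sparser than one of these finitely
    many candidates has the smaller [h_pq]-norm once [p] is small enough. *)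
Require Import Defs.
From mathcomp Require Import all_boot all_order all_algebra.
From mathcomp Require Import boolp classical_sets reals exp.
From mathcomp Require Import lra.
From mathcomp Require Import unstable interval_inference filter topology normedtype.
From mathcomp Require Import convex hoelder.
Import Order.TTheory GRing.Theory Num.Theory.
Import numFieldNormedType.Exports.
Local Open Scope classical_set_scope.
Local Open Scope ring_scope.

(* Concavity of [t `^ q], read off the convexity of its inverse [t `^ q^-1]. *)
Lemma powR_midpoint_le (R : realType) (q a e : R) :
  0 < q -> q <= 1 -> `|e| <= a -> (a + e) `^ q + (a - e) `^ q <= a `^ q *+ 2.
Proof.
move=> q0 q1; rewrite ler_norml => /andP[ea1 ea2].
have ap : 0 <= a + e by lra.
have am : 0 <= a - e by lra.
have r1 : 1 <= q^-1 by rewrite invf_ge1.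
have half_ge0 : 0 <= 2^-1 :> R by lra.
have half_le1 : 2^-1 <= 1 :> R by lra.
set u := (a + e) `^ q; set v := (a - e) `^ q.
have u0 : 0 <= u by exact: powR_ge0.
have v0 : 0 <= v by exact: powR_ge0.
have powK (w : R) : 0 <= w -> (w `^ q) `^ q^-1 = w.
  by move=> w0; rewrite -powRrM divff ?gt_eqF// powRr1.
have powK' (w : R) : 0 <= w -> (w `^ q^-1) `^ q = w.
  by move=> w0; rewrite -powRrM mulVf ?gt_eqF// powRr1.
have wa : (2^-1 * u + (1 - 2^-1) * v) `^ q^-1 <= a.
  have := @convex_powR R q^-1 r1 (Itv01 half_ge0 half_le1) u v.
  rewrite !inE /= !in_itv /= !andbT => /(_ u0 v0).
  rewrite !convRE /= !powK// [X in X `^ _]convRE /= /onem => /le_trans; apply; lra.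
have w0 : 0 <= 2^-1 * u + (1 - 2^-1) * v by lra.
have : ((2^-1 * u + (1 - 2^-1) * v) `^ q^-1) `^ q <= a `^ q.
  apply: ge0_ler_powR; rewrite ?nnegrE ?powR_ge0 ?(ltW q0)//; lra.
rewrite powK' // (mulr2n (a `^ q)); lra.
Qed.

Lemma h_pqN (R : realType) (p q a : R) : h_pq p q (- a) = h_pq p q a.
Proof. by rewrite /h_pq normrN. Qed.

Lemma h_pq0 (R : realType) (p q : R) : 0 < q -> h_pq p q 0 = 0.
Proof. by move=> q0; rewrite /h_pq normr0 powR0 ?gt_eqF// mul0r addr0 ln1. Qed.

(** After exponentiation this compares [(1 + u / p) * (1 + v / p)] with [(1 + w / p) ^+ 2], and
    expanding leaves only the sums and products of the powers to be compared. *)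
Lemma h_pq_midpoint_lt (R : realType) (p q a e : R) :
  0 < p -> 0 < q -> q <= 1 -> e != 0 -> `|e| < `|a| ->
  h_pq p q (a + e) + h_pq p q (a - e) < h_pq p q a *+ 2.
Proof.
move=> p0 q0 q1 e0.
wlog a0 : a e e0 / 0 <= a => [wl|].
  have [/wl|/ltW a0 ea] := leP 0 a; first exact.
  have := wl (- a) (- e); rewrite oppr_ge0 oppr_eq0 !normrN => /(_ e0 a0 ea).
  by rewrite -opprD -opprB opprK !h_pqN [- e + a]addrC -opprB h_pqN.
rewrite (ger0_norm a0) => ea.
have [ea1 ea2] : - a < e /\ e < a by apply/andP; rewrite -ltr_norml.
have ap : 0 < a + e by lra.
have am : 0 < a - e by lra.
have sum_le := powR_midpoint_le R q a e q0 q1 (ltW ea).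
(* The sum only gives a weak inequality; strictness comes from the product,
   since [(a + e) * (a - e) = a ^+ 2 - e ^+ 2]. *)
have prod_lt : (a + e) `^ q * (a - e) `^ q < a `^ q * a `^ q.
  rewrite -!powRM ?(ltW ap) ?(ltW am)//; apply: (gt0_ltr_powR q0);
    rewrite ?nnegrE ?mulr_ge0 ?(ltW ap) ?(ltW am)//.
  have : 0 < e * e by rewrite -expr2 exprn_even_gt0.
  by nra.
rewrite /h_pq (ger0_norm (ltW ap)) (ger0_norm (ltW am)) (ger0_norm a0).
have pos t : 0 < 1 + t `^ q / p.
  by rewrite ltr_pwDl// divr_ge0 ?powR_ge0 ?ltW.
rewrite mulr2n -!lnM ?posrE// ltr_ln ?posrE ?mulr_gt0//.
move: sum_le prod_lt.
set u := (a + e) `^ q; set v := (a - e) `^ q; set w := a `^ q => sum_le prod_lt.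
have pV : 0 < p^-1 by rewrite invr_gt0.
have s1 : (u + v) * p^-1 <= (w *+ 2) * p^-1 by rewrite ler_pM2r.
have s2 : u * v * (p^-1 * p^-1) < w * w * (p^-1 * p^-1).
  by rewrite ltr_pM2r// mulr_gt0.
rewrite mulr2n in s1; nra.
Qed.

Lemma minimizer_support_uniq (R : realType) (m n : nat) (A : 'M[R]_(m, n))
    (b : 'cV[R]_m) (p q : R) (x y : 'cV[R]_n) :
  0 < p -> 0 < q -> q <= 1 ->
  global_minimizer (norm_h_pq p q) (feasible A b) x -> feasible A b y ->
  (forall i, x i ord0 = 0 -> y i ord0 = 0) -> y = x.
Proof.
move=> p0 q0 q1 [Ax xmin] Ay supp; apply/eqP/negPn/negP => yx.
have [i0 zi0] : exists i, y i ord0 - x i ord0 != 0.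
  apply/not_existsP => z0; move/eqP: yx; apply.
  by apply/colP => i; apply/eqP; rewrite -subr_eq0; apply/negPn/negP/z0.
have [e e0 small] : exists2 e : R, 0 < e &
    forall i, x i ord0 != 0 -> `|e * (y i ord0 - x i ord0)| < `|x i ord0|.
  have near_i (i : 'I_n) : \forall e \near (0:R)^'+, x i ord0 != 0 ->
      `|e * (y i ord0 - x i ord0)| < `|x i ord0|.
    have [_|xi0] := eqVneq (x i ord0) 0; near=> e => // _.
    have e0 : 0 < e by near: e; exact: nbhs_right_gt.
    (* The [+ 1] keeps the divisor positive at coordinates where [x] and [y] agree. *)
    have z1 : 0 < `|y i ord0 - x i ord0| + 1 by rewrite ltr_wpDl.
    rewrite normrM (gtr0_norm e0).
    apply: (@le_lt_trans _ _ (e * (`|y i ord0 - x i ord0| + 1))).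
      by rewrite ler_pM2l// lerDl.
    rewrite -ltr_pdivlMr//; near: e; apply: nbhs_right_lt.
    by rewrite divr_gt0// normr_gt0.
  have [e [e0 He]] := filter_ex (filterI (nbhs_right_gt 0) (filter_forall _ near_i)).
  by exists e.
have feas s : feasible A b (x + s *: (y - x)).
  rewrite /feasible /= in Ax Ay *.
  by rewrite mulmxDr -scalemxAr mulmxBr Ax Ay subrr scaler0 addr0.
(* Adding minimality against both perturbations gives an inequality that strict midpoint concavity
   refutes coordinate by coordinate. *)
have := lerD (xmin _ (feas e)) (xmin _ (feas (- e))).
apply/negP; rewrite -ltNge /norm_h_pq -!big_split /=.
have strict i : y i ord0 - x i ord0 != 0 ->
    h_pq p q (x i ord0 + e * (y i ord0 - x i ord0))
    + h_pq p q (x i ord0 - e * (y i ord0 - x i ord0))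
    < h_pq p q (x i ord0) *+ 2.
  (* Off the support of [x] both points vanish, so a coordinate that moves lies in the support. *)
  move=> zi; have xi : x i ord0 != 0.
    by apply: contra_neq zi => xi; rewrite xi supp// subrr.
  by apply: h_pq_midpoint_lt => //; [rewrite mulf_neq0// gt_eqF|exact: small].
rewrite (bigD1 i0)//= [ltRHS](bigD1 i0)//=.
have entry i s : (x + s *: (y - x)) i ord0 = x i ord0 + s * (y i ord0 - x i ord0).
  by rewrite !mxE.
apply: ltr_leD; first by rewrite !entry mulNr -mulr2n strict.
apply: ler_sum => i _; rewrite !entry mulNr -mulr2n.
have [->|/strict/ltW//] := eqVneq (y i ord0 - x i ord0) 0.
by rewrite mulr0 subr0 addr0 mulr2n.
Unshelve. all: by end_near.
Qed.

Lemma norm_h_pq_support (R : realType) (n : nat) (p q : R) (x : 'cV[R]_n) :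
  0 < q ->
  norm_h_pq p q x = \sum_(i < n | x i ord0 != 0) h_pq p q (x i ord0).
Proof.
move=> q0; rewrite /norm_h_pq (bigID (fun i => x i ord0 != 0)) /=.
rewrite [X in _ + X]big1 ?addr0// => i /negPn/eqP->; exact: h_pq0.
Qed.

Lemma norm0_sum (R : realType) (n : nat) (x : 'cV[R]_n) (c : R) :
  \sum_(i < n | x i ord0 != 0) c = c * (norm0 x)%:R.
Proof. by rewrite sumr_const mulr_natr /norm0 cardsE. Qed.

(** For [p < 1], [1 + w / p <= (1 + w) / p], so each support entry costs at most [- ln p] plus a
    term free of [p]. *)
Lemma norm_h_pq_le (R : realType) (n : nat) (p q : R) (x : 'cV[R]_n) :
  0 < p -> p < 1 -> 0 < q ->
  norm_h_pq p q x <=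
  \sum_(i < n | x i ord0 != 0) ln (1 + `|x i ord0| `^ q) - ln p * (norm0 x)%:R.
Proof.
move=> p0 p1 q0; rewrite norm_h_pq_support// -norm0_sum -sumrB.
apply: ler_sum => i _; rewrite /h_pq.
have w0 := powR_ge0 `|x i ord0| q; move: (_ `^ q) w0 => w w0.
have w1 : 0 < 1 + w by lra.
have wp : 0 <= w / p by rewrite divr_ge0// ltW.
rewrite -ln_div ?posrE// ler_ln ?posrE ?divr_gt0//; last lra.
by rewrite mulrDl lerD2r mul1r invf_ge1// ltW.
Qed.

(** The matching lower bound comes from dropping the [1] in [1 + w / p]; on the support [w > 0], so
    [ln w] is meaningful. *)
Lemma norm_h_pq_ge (R : realType) (n : nat) (p q : R) (x : 'cV[R]_n) :
  0 < p -> 0 < q ->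
  \sum_(i < n | x i ord0 != 0) ln (`|x i ord0| `^ q) - ln p * (norm0 x)%:R
  <= norm_h_pq p q x.
Proof.
move=> p0 q0; rewrite norm_h_pq_support// -norm0_sum -sumrB.
apply: ler_sum => i xi; rewrite /h_pq.
have w0 : 0 < `|x i ord0| `^ q by rewrite powR_gt0// normr_gt0.
have wp : 0 < `|x i ord0| `^ q / p by rewrite divr_gt0.
by rewrite -ln_div ?posrE// ler_ln ?posrE//; lra.
Qed.

Lemma norm_h_pq_lt_near (R : realType) (n : nat) (q : R) (x y : 'cV[R]_n) :
  0 < q -> (norm0 y < norm0 x)%N ->
  \forall p \near (0:R)^'+, norm_h_pq p q y < norm_h_pq p q x.
Proof.
move=> q0 yx.
pose U := \sum_(i < n | y i ord0 != 0) ln (1 + `|y i ord0| `^ q).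
pose L := \sum_(i < n | x i ord0 != 0) ln (`|x i ord0| `^ q).
near=> p.
have p0 : 0 < p by near: p; exact: nbhs_right_gt.
have p1 : p < 1 by near: p; exact: nbhs_right_lt.
(* The supports differ by at least one entry in size, so the gap between the bounds is at least
   [L - U - ln p]. *)
have pUL : ln p < L - U.
  rewrite -[ltRHS]expRK ltr_ln ?posrE ?expR_gt0//.
  by near: p; apply: nbhs_right_lt; exact: expR_gt0.
apply: le_lt_trans (@norm_h_pq_le R n p q y p0 p1 q0) _.
apply: lt_le_trans (@norm_h_pq_ge R n p q x p0 q0).
rewrite -/U -/L.
have lnp : ln p < 0 by rewrite ln_lt0// p0.
have : (norm0 y)%:R + 1 <= (norm0 x)%:R :> R by rewrite natr1 ler_nat.
nra.
Unshelve. all: by end_near.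
Qed.

Theorem theorem1 (R : realType) (m n : nat) (A : 'M[R]_(m, n)) (b : 'cV[R]_m)
    (q : R) (q_gt0 : 0 < q) (q_le1 : q <= 1) :
  exists pstar : R, 0 < pstar /\
    forall p : R, 0 < p -> p < pstar ->
    forall x : 'cV[R]_n,
      global_minimizer (norm_h_pq p q) (feasible A b) x ->
      global_minimizer (@norm0 R n) (feasible A b) x.
Proof.
pose supp (x : 'cV[R]_n) : {set 'I_n} := [set i | x i ord0 != 0]%SET.
(* The threshold may depend on the support [S] but not on [x]; there are only finitely many [S]. *)
have near_S (S : {set 'I_n}) : \forall p \near (0:R)^'+,
    forall x, supp x = S -> 0 < p ->
    global_minimizer (norm_h_pq p q) (feasible A b) x ->
    global_minimizer (@norm0 R n) (feasible A b) x.
  have [[x0 [p1 [p10 suppx0 x0min]]]|none] := pselect (exists x0 p1,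
      [/\ 0 < p1, supp x0 = S &
          global_minimizer (norm_h_pq p1 q) (feasible A b) x0]); last first.
    by near=> p => x xS p0 xmin; case: none; exists x, p.
  (* The representative [x0] minimizes for its own [p1], yet uniqueness needs only feasibility of
     [x], so it identifies minimizers for every other [p] as well. *)
  have suppE x : supp x = S -> feasible A b x -> x = x0.
    move=> xS Ax.
    apply: (@minimizer_support_uniq _ _ _ A b p1 q) => // i x0i.
    have : i \notin supp x by rewrite xS -suppx0 inE x0i eqxx.
    by rewrite inE negbK => /eqP.
  have [x0min0|] := pselect (global_minimizer (@norm0 R n) (feasible A b) x0).
    by near=> p => x xS _ [Ax _]; rewrite (suppE x).
  move=> x0Nmin0; have [y Ay yx0] : exists2 y, feasible A b y & (norm0 y < norm0 x0)%N.
    apply: contra_notP x0Nmin0 => noy; split; first by case: x0min.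
    move=> y Ay; rewrite leEnat leqNgt; apply/negP => yx0; apply: noy.
    by exists y.
  (* Both [y] and [x0] are fixed before [p], so for small [p] the sparser [y] beats [x0], which is
     then no minimizer. *)
  near=> p => x xS _ [Ax xmin]; exfalso.
  have := xmin _ Ay; rewrite (suppE x)//; apply/negP; rewrite -ltNge.
  by near: p; exact: norm_h_pq_lt_near.
(* Intersecting the finitely many neighbourhoods gives one radius [d], which serves as [pstar]. *)
have /nbhs_norm0P[d /= d0 Hd] := filter_forall (at_right_proper_filter 0) near_S.
exists d; split=> // p p0 pd x xmin.
by apply: (Hd p _ p0 (supp x)); rewrite //= gtr0_norm.
Unshelve. all: by end_near.
Qed.
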